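(* Let $A\in\mathbb{H}^{m\times n}$, $B\in\mathbb{H}^{m\times p_1}$, $C\in\mathbb{H}^{m\times p_2}$, $D\in\mathbb{H}^{q_1\times n}$ and $E\in\mathbb{H}^{q_2\times n}$ be given. Suppose that the real quaternion matrix equation $BXD+CYE=A$ (with unknowns $X\in\mathbb{H}^{p_1\times q_1}$, $Y\in\mathbb{H}^{p_2\times q_2}$) is consistent. Then $$\min_{BXD+CYE=A} r(X)=r\begin{bmatrix}A&C\end{bmatrix}+r\begin{bmatrix}A\\ E\end{bmatrix}-r\begin{bmatrix}A&C\\ E&0\end{bmatrix},$$ $$\min_{BXD+CYE=A} r(Y)=r\begin{bmatrix}A&B\end{bmatrix}+r\begin{bmatrix}A\\ D\end{bmatrix}-r\begin{bmatrix}A&B\\ D&0\end{bmatrix}.$$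
   Context: $\mathbb{H}$ is the real quaternion algebra and $\mathbb{H}^{m\times n}$ is the set of $m\times n$ matrices over $\mathbb{H}$. The rank $r(M)$ of a quaternion matrix $M$ is the dimension of its column right space (equivalently, of its row left space). Each minimum is taken over all solution pairs $(X,Y)$ of the equation $BXD+CYE=A$. *)

(* Defs.v *)
From HB Require Import structures.
From mathcomp Require Import all_boot all_order all_algebra.
From mathcomp Require Import boolp classical_sets reals.
From mathcomp Require Import ring lra.

Set Implicit Arguments.
Unset Strict Implicit.
Unset Printing Implicit Defensive.

Import Order.TTheory GRing.Theory Num.Theory.
Local Open Scope classical_set_scope.
Local Open Scope ring_scope.

(* [Quat a b c d] is a + b i + c j + d k. *)
Record quat (R : Type) := Quat { qre : R; qi : R; qj : R; qk : R }.

Section QuatChoice.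
Variable R : choiceType.

Definition prod_of_quat (x : quat R) := (qre x, qi x, qj x, qk x).
Definition quat_of_prod (x : R * R * R * R) :=
  let: (a, b, c, d) := x in Quat a b c d.

Lemma prod_of_quatK : cancel prod_of_quat quat_of_prod.
Proof. by case. Qed.

HB.instance Definition _ := Choice.copy (quat R) (can_type prod_of_quatK).

End QuatChoice.

Section QuatRing.
Variable R : realType.
Implicit Types x y z : quat R.

Definition qadd x y :=
  Quat (qre x + qre y) (qi x + qi y) (qj x + qj y) (qk x + qk y).
Definition qopp x := Quat (- qre x) (- qi x) (- qj x) (- qk x).

Lemma qaddA : associative qadd.
Proof. by move=> [? ? ? ?] [? ? ? ?] [? ? ? ?]; rewrite /qadd /= !addrA. Qed.
Lemma qaddC : commutative qadd.
Proof. by move=> [? ? ? ?] [? ? ? ?]; congr Quat; rewrite /= addrC. Qed.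
Lemma qadd0 : left_id (Quat 0 0 0 0) qadd.
Proof. by move=> [? ? ? ?]; rewrite /qadd /= !add0r. Qed.
Lemma qaddN : left_inverse (Quat 0 0 0 0) qopp qadd.
Proof. by move=> [? ? ? ?]; rewrite /qadd /= !addNr. Qed.

HB.instance Definition _ :=
  GRing.isZmodule.Build (quat R) qaddA qaddC qadd0 qaddN.

Definition qmul x y :=
  let: Quat a b c d := x in
  let: Quat a' b' c' d' := y in
  Quat (a * a' - b * b' - c * c' - d * d')
       (a * b' + b * a' + c * d' - d * c')
       (a * c' - b * d' + c * a' + d * b')
       (a * d' + b * c' - c * b' + d * a').

Lemma qmulA : associative qmul.
Proof. by move=> [? ? ? ?] [? ? ? ?] [? ? ? ?]; congr Quat; ring. Qed.
Lemma qmul1l : left_id (Quat 1 0 0 0) qmul.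
Proof. by move=> [? ? ? ?]; congr Quat; ring. Qed.
Lemma qmul1r : right_id (Quat 1 0 0 0) qmul.
Proof. by move=> [? ? ? ?]; congr Quat; ring. Qed.
Lemma qmulDl : left_distributive qmul qadd.
Proof. by move=> [? ? ? ?] [? ? ? ?] [? ? ? ?]; congr Quat => /=; ring. Qed.
Lemma qmulDr : right_distributive qmul qadd.
Proof. by move=> [? ? ? ?] [? ? ? ?] [? ? ? ?]; congr Quat => /=; ring. Qed.
Lemma qone_neq0 : Quat 1 0 0 0 != 0 :> quat R.
Proof. by apply/eqP => -[] /eqP; rewrite oner_eq0. Qed.

HB.instance Definition _ := GRing.Zmodule_isNzRing.Build (quat R)
  qmulA qmul1l qmul1r qmulDl qmulDr qone_neq0.

Definition qnorm2 x := qre x ^+ 2 + qi x ^+ 2 + qj x ^+ 2 + qk x ^+ 2.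

Definition qinv x :=
  Quat (qre x / qnorm2 x) (- qi x / qnorm2 x)
       (- qj x / qnorm2 x) (- qk x / qnorm2 x).

Lemma qnorm2_eq0 x : (qnorm2 x == 0) = (x == 0).
Proof.
apply/eqP/eqP => [|->]; last by rewrite /qnorm2 /= expr0n /= !addr0.
case: x => a b c d; rewrite /qnorm2 /= => h.
have := sqr_ge0 a; have := sqr_ge0 b; have := sqr_ge0 c; have := sqr_ge0 d.
move=> hd hc hb ha.
by congr Quat; apply/eqP; rewrite -sqrf_eq0; apply/eqP; lra.
Qed.

Lemma qinv0 : qinv 0 = 0.
Proof. by congr Quat; rewrite /= ?oppr0 mul0r. Qed.

Lemma qmulVr x : x != 0 -> qinv x * x = 1.
Proof.
rewrite -qnorm2_eq0; case: x => a b c d; rewrite /qnorm2 /= => n0.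
by congr Quat; rewrite /qnorm2 /=; field.
Qed.

Lemma qmulrV x : x != 0 -> x * qinv x = 1.
Proof.
rewrite -qnorm2_eq0; case: x => a b c d; rewrite /qnorm2 /= => n0.
by congr Quat; rewrite /qnorm2 /=; field.
Qed.

Lemma quat_unitP x y : y * x = 1 /\ x * y = 1 -> x != 0.
Proof.
by case=> _ xy; apply/eqP => x0; move/eqP: xy; rewrite x0 mul0r eq_sym oner_eq0.
Qed.

Lemma qinv_out x : ~~ (x != 0) -> qinv x = x.
Proof. by rewrite negbK => /eqP ->; exact: qinv0. Qed.

HB.instance Definition _ := GRing.NzRing_hasMulInverse.Build (quat R)
  (unit_subdef := [pred x | x != 0]) qmulVr qmulrV quat_unitP qinv_out.

Lemma quat_unitE x : (x \is a GRing.unit) = (x != 0).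
Proof. by []. Qed.

End QuatRing.

Section Rank.
Variable K : nzRingType.

(* Acting on columns by [M *m v] multiplies the entries of [M] by scalars on
   the right, so this is the right span of the columns of [M]. *)
Definition colspace m n (M : 'M[K]_(m, n)) : set 'cV[K]_m :=
  range (fun v : 'cV[K]_n => M *m v).

Definition right_free m k (b : 'M[K]_(m, k)) :=
  forall c : 'cV[K]_k, b *m c = 0 -> c = 0.

Definition right_basis m k (V : set 'cV[K]_m) (b : 'M[K]_(m, k)) :=
  right_free b /\ colspace b = V.

Definition right_dim m (V : set 'cV[K]_m) : nat :=
  xget 0%N [set k | exists b : 'M[K]_(m, k), right_basis V b].

Definition qrank m n (M : 'M[K]_(m, n)) : nat := right_dim (colspace M).

End Rank.

Section RankTheory.
Variable R : realType.
Local Notation K := (quat R).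

Lemma sub_colspace m n k (M : 'M[K]_(m, n)) (N : 'M[K]_(m, k)) :
  colspace M `<=` colspace N -> exists P : 'M[K]_(k, n), M = N *m P.
Proof.
move=> sMN; have h j : exists v : 'cV[K]_k, N *m v = col j M.
  have [|v _ vE] := sMN (col j M); last by exists v.
  by exists (delta_mx j 0) => //; rewrite colE.
have [f fE] := boolp.choice h; exists (\matrix_(i, j) f j i 0).
apply/matrixP => i j; have /matrixP /(_ i 0) := fE j; rewrite !mxE => <-.
by apply: eq_bigr => l _; rewrite mxE.
Qed.

Lemma nontrivial_kernel m n (N : 'M[K]_(m, n)) : (m < n)%N ->
  exists2 x : 'cV[K]_n, x != 0 & N *m x = 0.
Proof.
elim: m n N => [|m IH] n N lt_mn.
  case: n N lt_mn => // n N _; exists (const_mx 1); last by rewrite [LHS]flatmx0.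
  by apply/eqP => /matrixP /(_ 0 0) /eqP; rewrite !mxE oner_eq0.
case: n N lt_mn => // n; rewrite -[m.+1]/(1 + m)%N => N lt_mn.
have [/existsP[j Nj]|/existsPn h] := boolP [exists j, N 0 j != 0].
  pose P : 'M[K]_(n.+1, n) := \matrix_(l, i)
    if unlift j l is Some l' then (l' == i)%:R else - (N 0 j)^-1 * N 0 (lift j i).
  have [y y0 Ny] := IH n (dsubmx N *m P) lt_mn.
  exists (P *m y).
    apply: contraNneq y0 => /matrixP Py; apply/eqP/matrixP => i o.
    have := Py (lift j i) o; rewrite !mxE (bigD1 i) //= big1 => [|i' ne].
      by rewrite mxE liftK eqxx mul1r addr0.
    by rewrite mxE liftK eq_sym (negbTE ne) mul0r.
  rewrite -[N]vsubmxK mul_col_mx mulmxA (mulmxA (dsubmx N)) Ny.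
  suff -> : usubmx N *m P = 0 by rewrite mul0mx col_mx0.
  apply/matrixP => o i; rewrite !mxE (bigD1_ord j) //= !mxE unlift_none.
  have -> : lshift m o = 0 by rewrite ord1; exact: val_inj.
  rewrite mulrA mulrN divrr // mulN1r (bigD1 i) //= big1 => [|i' ne].
    rewrite !mxE liftK eqxx mulr1 addr0.
    have -> : lshift m o = 0 by rewrite ord1; exact: val_inj.
    by rewrite addNr.
  by rewrite !mxE liftK (negbTE ne) mulr0.
have [x x0 Nx] := IH n.+1 (dsubmx N) (ltnW lt_mn).
exists x => //; rewrite -[N]vsubmxK mul_col_mx Nx.
suff -> : usubmx N = 0 by rewrite mul0mx col_mx0.
apply/matrixP => o j; rewrite !mxE; apply/eqP.
have -> : lshift m o = 0 by rewrite ord1; exact: val_inj.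
exact/negbNE/h.
Qed.

Lemma right_basis_leq m k k' (V : set 'cV[K]_m)
    (b : 'M[K]_(m, k)) (b' : 'M[K]_(m, k')) :
  right_basis V b -> right_basis V b' -> (k <= k')%N.
Proof.
move=> [bf bV] [_ b'V]; rewrite leqNgt; apply/negP => lt.
have [|P bP] := @sub_colspace _ _ _ b b'; first by rewrite bV b'V.
have [x /eqP x0 Px] := nontrivial_kernel P lt.
by apply: x0; apply: bf; rewrite bP -mulmxA Px mulmx0.
Qed.

Lemma right_basis_exists m n (M : 'M[K]_(m, n)) :
  exists k (b : 'M[K]_(m, k)), right_basis (colspace M) b.
Proof.
elim: n M => [|n IH] M.
  by exists 0%N, M; split=> [c _|//]; exact: flatmx0.
have [Mf|/existsNP[c /not_implyP[Mc /eqP c0]]] := EM (right_free M).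
  by exists n.+1, M.
have {c0} [j cj] : exists j, c j 0 != 0.
  apply/existsP; apply: contraNT c0 => /existsPn h.
  by apply/eqP/matrixP => i o; rewrite ord1 mxE; apply/eqP/negbNE/h.
have [k [b [bf bV]]] := IH (col' j M); exists k, b; split=> //; rewrite bV.
have mulE p (A : 'M[K]_(p, n.+1)) (v : 'cV[K]_n.+1) :
    A *m v = col j A *m row j v + col' j A *m row' j v.
  apply/matrixP => i o; rewrite !mxE (bigD1_ord j) //= big_ord1 !mxE.
  by congr (_ + _); apply: eq_bigr => l _; rewrite !mxE.
apply/seteqP; split=> _ [v _ <-].
  exists (\col_i (if unlift j i is Some l then v l 0 else 0)) => //.
  rewrite mulE.
  have -> : row j (\col_i (if unlift j i is Some l then v l 0 else 0)) = 0 :> 'M[K]_1.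
    by apply/matrixP => a o; rewrite !mxE unlift_none.
  rewrite mulmx0 add0r; congr (_ *m _).
  by apply/matrixP => a o; rewrite !mxE liftK ord1.
exists (row' j v - row' j c *m (((c j 0)^-1)%:M *m row j v)) => //.
rewrite mulE mulmxBr mulmxA addrC; congr (_ + _).
have /eqP := Mc; rewrite mulE addrC addr_eq0 => /eqP ->.
rewrite mulNmx opprK -mulmxA; congr (_ *m _).
apply/matrixP => a o; rewrite !ord1 !mxE big_ord1 !mxE big_ord1 !mxE.
by rewrite mulr1n mulrA mulrV ?mul1r.
Qed.

Lemma qrankP m n (M : 'M[K]_(m, n)) :
  exists b : 'M[K]_(m, qrank M), right_basis (colspace M) b.
Proof.
exact: (xgetPex 0%N (right_basis_exists M)
  : [set k | exists b : 'M[K]_(m, k), right_basis (colspace M) b] (qrank M)).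
Qed.

Lemma qrank_unique m n (M : 'M[K]_(m, n)) k (b : 'M[K]_(m, k)) :
  right_basis (colspace M) b -> qrank M = k.
Proof.
move=> bV; have [b' b'V] := qrankP M.
by apply/eqP; rewrite eqn_leq (right_basis_leq b'V bV) (right_basis_leq bV b'V).
Qed.

End RankTheory.

Definition is_min (S : set int) (a : int) := S a /\ lbound S a.

(* Main.v *)
(* Write [C^-] for a generalized inverse of [C], and let [P = 1 - C C^-] and
   [Q = 1 - E^- E]. Block elimination gives [r[A C] = r(C) + r(PA)],
   [r[A; E] = r(E) + r(AQ)] and [r[A C; E 0] = r(C) + r(E) + r(PAQ)], so the
   claimed minimum is [r(PA) + r(AQ) - r(PAQ)], in which [A] may be replaced by
   [M = BXD] for any solution [(X, Y)]. Frobenius' inequality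
   [r(PM) + r(MQ) <= r(M) + r(PMQ)] is the lower bound. For the converse, there
   is an [N = M Z M] with [PN = PM] and [NQ = MQ] that attains equality in it:
   [M - N] is then of the form [C _ E], and [X = B^- N D^-] solves [BXD = N]
   because [N] inherits its column and row spaces from [M]. *)

Require Import Defs.
From mathcomp Require Import all_boot all_order all_algebra.
From mathcomp Require Import boolp classical_sets reals.
From mathcomp Require Import zify.

Set Implicit Arguments.
Unset Strict Implicit.
Unset Printing Implicit Defensive.

Local Open Scope classical_set_scope.
Local Open Scope ring_scope.

Import GRing.Theory.

Section QuaternionRank.
Variable R : realType.
Local Notation K := (quat R).

(** * Rank factorizations and elementary rank inequalities *)

Lemma rank_factorization m n (M : 'M[K]_(m, n)) :
  exists (b : 'M[K]_(m, qrank M)) (c : 'M[K]_(qrank M, n))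
    (s : 'M[K]_(n, qrank M)), [/\ right_free b, M = b *m c & b = M *m s].
Proof.
have [b [bf bM]] := qrankP M.
have [|c Mb] := @sub_colspace _ _ _ _ M b; first by rewrite bM.
have [|s bs] := @sub_colspace _ _ _ _ b M; first by rewrite bM.
by exists b, c, s.
Qed.

(** If the rank exceeded [k], then [c *m s] would be wider than tall and kill some nonzero [x], and
    so would the basis [b' = b *m c *m s], which is free. *)
Lemma qrank_mul_leq m n k (b : 'M[K]_(m, k)) (c : 'M[K]_(k, n)) :
  (qrank (b *m c) <= k)%N.
Proof.
have [b' [_ [s [b'f _ b's]]]] := rank_factorization (b *m c).
rewrite leqNgt; apply/negP => /(@nontrivial_kernel R _ _ (c *m s)).
move=> [x /eqP x0 cx]; apply: x0; apply: b'f.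
by rewrite b's -!mulmxA (mulmxA c) cx mulmx0.
Qed.

Lemma qrank_mulmx3 m n k l (U : 'M[K]_(m, k)) (M : 'M[K]_(k, l))
  (V : 'M[K]_(l, n)) : (qrank (U *m M *m V) <= qrank M)%N.
Proof.
have [b [c [_ [_ Mbc _]]]] := rank_factorization M.
by rewrite {1}Mbc mulmxA -mulmxA; exact: qrank_mul_leq.
Qed.

Lemma qrank_mulmxl m n k (U : 'M[K]_(m, k)) (M : 'M[K]_(k, n)) :
  (qrank (U *m M) <= qrank M)%N.
Proof. by rewrite -[U *m M]mulmx1; exact: qrank_mulmx3. Qed.

Lemma qrank_mulmxr m n k (M : 'M[K]_(m, k)) (V : 'M[K]_(k, n)) :
  (qrank (M *m V) <= qrank M)%N.
Proof. by rewrite -{1}[M]mul1mx; exact: qrank_mulmx3. Qed.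

Lemma qrankD m n (M N : 'M[K]_(m, n)) :
  (qrank (M + N) <= qrank M + qrank N)%N.
Proof.
have [b [c [_ [_ Mbc _]]]] := rank_factorization M.
have [b' [c' [_ [_ Nbc _]]]] := rank_factorization N.
by rewrite {1}Mbc {1}Nbc -mul_row_col; exact: qrank_mul_leq.
Qed.

Lemma qrank_diag m n k l (M : 'M[K]_(m, n)) (N : 'M[K]_(k, l)) :
  qrank (block_mx M 0 0 N) = (qrank M + qrank N)%N.
Proof.
have [b [c [s [bf Mb bM]]]] := rank_factorization M.
have [b' [c' [s' [bf' Nb bN]]]] := rank_factorization N.
apply: (@qrank_unique _ _ _ _ _ (block_mx b 0 0 b')); split.
  move=> x; rewrite -[x]vsubmxK mul_block_col !mul0mx addr0 add0r.
  by rewrite -col_mx0 => /eq_col_mx[/bf -> /bf' ->]; rewrite col_mx0.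
have Eb : block_mx M 0 0 N = block_mx b 0 0 b' *m block_mx c 0 0 c'.
  by rewrite mulmx_block !mulmx0 !mul0mx !addr0 !add0r -Mb -Nb.
have EM : block_mx b 0 0 b' = block_mx M 0 0 N *m block_mx s 0 0 s'.
  by rewrite mulmx_block !mulmx0 !mul0mx !addr0 !add0r -bM -bN.
apply/seteqP; split=> _ [v _ <-].
  by exists (block_mx s 0 0 s' *m v) => //; rewrite mulmxA -EM.
by exists (block_mx c 0 0 c' *m v) => //; rewrite mulmxA -Eb.
Qed.

(** * Generalized inverses *)

Lemma ginverse_exists m n (M : 'M[K]_(m, n)) :
  exists G : 'M[K]_(n, m), M *m G *m M = M.
Proof.
elim: n M => [|n IH].
  by move=> M; exists 0; rewrite [LHS]thinmx0 [RHS]thinmx0.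
rewrite -addn1 => M; rewrite -[M]hsubmxK.
move: (lsubmx M) (rsubmx M) => N v; have [G NGN] := IH N.
(* Induction on columns: [P] kills [N], so [w = P *m v] is what the new column [v] adds to the
   column space of [N]. If [w = 0], a zero row appended to [G] suffices. *)
pose P := 1%:M - N *m G.
have [w wP] : exists w, w = P *m v by exists (P *m v).
have PN : P *m N = 0 by rewrite mulmxBl mul1mx NGN subrr.
have wE : w = v - N *m G *m v by rewrite wP mulmxBl mul1mx.
have [w0|/eqP w0] := EM (w = 0).
  exists (col_mx G 0); rewrite mul_row_col mulmx0 addr0 mul_mx_row NGN.
  by congr row_mx; apply/esym/eqP; rewrite -subr_eq0 -wE w0.
have [i wi] : exists i, w i 0 != 0.
  apply/existsP; apply: contraNT w0 => /existsPn h.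
  by apply/eqP/matrixP => i o; rewrite ord1 mxE; apply/eqP/negbNE/h.
pose u : 'rV[K]_m := (w i 0)^-1 *: delta_mx 0 i.
have uw : u *m w = 1%:M.
  apply/matrixP => o o'; rewrite !ord1 !mxE (bigD1 i) //= big1 => [|j ji].
    by rewrite !mxE !eqxx mulr1 addr0 mulVr.
  by rewrite !mxE (negbTE ji) mulr0 mul0r.
(* A Greville-type update. The new row [u *m P] sends [N] to 0 and [v] to 1; the correction of [G]
   makes the product with [M] equal to [N *m G + w *m (u *m P)], which fixes both [N] and [v]. *)
exists (col_mx (G - G *m v *m (u *m P)) (u *m P)).
have -> : row_mx N v *m col_mx (G - G *m v *m (u *m P)) (u *m P)
    = N *m G + w *m (u *m P).
  by rewrite mul_row_col mulmxBr wE mulmxBl !mulmxA addrAC addrA.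
rewrite mul_mx_row !mulmxDl NGN -!mulmxA PN !mulmx0 addr0.
by rewrite -wP uw mulmx1 wE -mulmxA addrC subrK.
Qed.

Lemma refl_ginverse_exists m n (M : 'M[K]_(m, n)) :
  exists G : 'M[K]_(n, m), M *m G *m M = M /\ G *m M *m G = G.
Proof.
have [G MGM] := ginverse_exists M; exists (G *m M *m G); split.
  by rewrite !mulmxA !MGM.
by rewrite -!mulmxA (mulmxA M) (mulmxA (M *m G)) MGM !mulmxA -!(mulmxA G) MGM.
Qed.

(** * Ranks of block matrices *)

Lemma qrank_row_mx m n k (M : 'M[K]_(m, n)) (C : 'M[K]_(m, k))
    (G : 'M[K]_(k, m)) : C *m G *m C = C ->
  qrank (row_mx M C) = (qrank C + qrank ((1%:M - C *m G) *m M))%N.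
Proof.
set P := 1%:M - _ => CGC.
have PC : P *m C = 0 by rewrite mulmxBl mul1mx CGC subrr.
rewrite [RHS]addnC -qrank_diag; apply/eqP; rewrite eqn_leq; apply/andP; split.
  have -> : row_mx M C = row_mx 1%:M 1%:M *m block_mx (P *m M) 0 0 C
      *m block_mx 1%:M 0 (G *m M) 1%:M.
    rewrite mul_row_block !mul1mx addr0 add0r mul_row_block !mulmx1 mulmx0 add0r.
    by rewrite mulmxBl mul1mx -mulmxA subrK.
  exact: qrank_mulmx3.
(* Column operations turn [M] into [P *m M]; then the complementary projections [P] and [C *m G]
   separate the two blocks. *)
have -> : block_mx (P *m M) 0 0 C = col_mx P (C *m G) *m row_mx M C
    *m block_mx 1%:M 0 (- (G *m M)) 1%:M.
  rewrite mul_col_row mulmx_block !mulmx1 !mulmx0 !add0r PC CGC mul0mx addr0.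
  by rewrite mulmxN -mulmxA subrr.
exact: qrank_mulmx3.
Qed.

Lemma qrank_col_mx m n k (M : 'M[K]_(m, n)) (E : 'M[K]_(k, n))
    (G : 'M[K]_(n, k)) : E *m G *m E = E ->
  qrank (col_mx M E) = (qrank E + qrank (M *m (1%:M - G *m E)))%N.
Proof.
set Q := 1%:M - _ => EGE.
have EQ : E *m Q = 0 by rewrite mulmxBr mulmx1 mulmxA EGE subrr.
rewrite [RHS]addnC -qrank_diag; apply/eqP; rewrite eqn_leq; apply/andP; split.
  have -> : col_mx M E = block_mx 1%:M (M *m G) 0 1%:M
      *m block_mx (M *m Q) 0 0 E *m col_mx 1%:M 1%:M.
    rewrite -mulmxA mul_block_col !mulmx1 addr0 add0r mul_block_col !mul1mx.
    by rewrite mul0mx add0r mulmxBr mulmx1 !mulmxA subrK.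
  exact: qrank_mulmx3.
have -> : block_mx (M *m Q) 0 0 E = block_mx 1%:M (- (M *m G)) 0 1%:M
    *m col_mx M E *m row_mx Q (G *m E).
  rewrite -mulmxA mul_col_row mulmx_block !mul1mx !mul0mx !add0r EQ (mulmxA E).
  by rewrite EGE mulmx0 addr0 mulNmx mulmxA subrr.
exact: qrank_mulmx3.
Qed.

Lemma qrank_block_mx0 m n k l (M : 'M[K]_(m, n)) (C : 'M[K]_(m, k))
    (E : 'M[K]_(l, n)) (G : 'M[K]_(k, m)) (H : 'M[K]_(n, l)) :
  C *m G *m C = C -> E *m H *m E = E ->
  qrank (block_mx M C E 0) =
    (qrank C + qrank E + qrank ((1%:M - C *m G) *m M *m (1%:M - H *m E)))%N.
Proof.
move=> CGC EHE.
have C0 : qrank (col_mx C (0 : 'M[K]_(l, k))) = qrank C.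
  have CE : col_mx C (0 : 'M[K]_(l, k)) = col_mx 1%:M 0 *m C.
    by rewrite mul_col_mx mul1mx mul0mx.
  have EC : C = row_mx 1%:M 0 *m col_mx C (0 : 'M[K]_(l, k)).
    by rewrite mul_row_col mul1mx mul0mx addr0.
  by apply/eqP; rewrite eqn_leq {1}CE qrank_mulmxl {1}EC qrank_mulmxl.
have CG0 : col_mx C 0 *m row_mx G (0 : 'M_(k, l)) *m col_mx C 0
    = col_mx C (0 : 'M[K]_(l, k)).
  by rewrite -mulmxA mul_row_col mul0mx addr0 mul_col_mx mul0mx mulmxA CGC.
(* The projection attached to [[C; 0]] is [diag(1 - C G, 1)], so what remains is the column
   [[(1 - C G) M; E]]. *)
rewrite block_mxEh (qrank_row_mx _ CG0) C0 -addnA; congr (_ + _)%N.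
rewrite -(qrank_col_mx _ EHE) mul_col_row !mul0mx mulmx0.
rewrite (@scalar_mx_block _ m l 1) opp_block_mx add_block_mx.
by rewrite !oppr0 !addr0 mul_block_col mul0mx addr0 mul0mx add0r mul1mx.
Qed.

(** * Frobenius' inequality and its equality case *)

Lemma qrank_sub_colspace m n k (V : 'M[K]_(m, n)) (U : 'M[K]_(n, k))
    (G : 'M[K]_(k, m)) (W := V *m U) : W *m G *m W = W ->
  qrank V = (qrank W + qrank ((1%:M - W *m G) *m V))%N.
Proof.
(* The columns of [W] already lie in the column space of [V], so appending them leaves the rank
   unchanged. *)
move=> WGW; rewrite -qrank_row_mx //.
have VW : row_mx V W = V *m row_mx 1%:M U by rewrite mul_mx_row mulmx1.
have WV : V = row_mx V W *m col_mx 1%:M 0.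
  by rewrite mul_row_col mulmx1 mulmx0 addr0.
by apply/eqP; rewrite eqn_leq {1}WV qrank_mulmxr VW qrank_mulmxr.
Qed.

Lemma qrank_sub_rowspace m n k (V : 'M[K]_(m, n)) (U : 'M[K]_(k, m))
    (G : 'M[K]_(n, k)) (W := U *m V) : W *m G *m W = W ->
  qrank V = (qrank W + qrank (V *m (1%:M - G *m W)))%N.
Proof.
move=> WGW; rewrite -qrank_col_mx //.
have VW : col_mx V W = col_mx 1%:M U *m V by rewrite mul_col_mx mul1mx.
have WV : V = row_mx 1%:M 0 *m col_mx V W.
  by rewrite mul_row_col mul1mx mul0mx addr0.
by apply/eqP; rewrite eqn_leq {1}WV qrank_mulmxl VW qrank_mulmxl.
Qed.

(** Compares [r(PM) - r(PMQ)] with [r(M) - r(MQ)]. Each difference is the rank of a projected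
    remainder, and since [J] kills [M *m Q], the first remainder is [J] times the second. *)
Lemma qrank_Frobenius m n k l (P : 'M[K]_(k, m)) (M : 'M[K]_(m, n))
    (Q : 'M[K]_(n, l)) :
  (qrank (P *m M) + qrank (M *m Q) <= qrank M + qrank (P *m M *m Q))%N.
Proof.
have [G WGW] := ginverse_exists (P *m M *m Q).
have [H MQH] := ginverse_exists (M *m Q).
rewrite (qrank_sub_colspace WGW) (qrank_sub_colspace MQH).
set W := P *m M *m Q in WGW *.
set J := (1%:M - W *m G) *m P.
have JMQ : J *m (M *m Q) = 0.
  by rewrite /J -mulmxA (mulmxA P) mulmxBl mul1mx WGW subrr.
have -> : (1%:M - W *m G) *m (P *m M) = J *m ((1%:M - M *m Q *m H) *m M).
  rewrite [RHS]mulmxA mulmxBr mulmx1 (mulmxA J) JMQ mul0mx subr0.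
  exact: mulmxA.
rewrite [leqLHS]addnC -addnA leq_add2l [leqRHS]addnC leq_add2l.
exact: qrank_mulmxl.
Qed.

Lemma qrank_Frobenius_attained m n k l (P : 'M[K]_(k, m)) (M : 'M[K]_(m, n))
    (Q : 'M[K]_(n, l)) :
  exists Z : 'M[K]_(n, m),
    [/\ P *m (M *m Z *m M) = P *m M, M *m Z *m M *m Q = M *m Q
      & (qrank (M *m Z *m M) + qrank (P *m M *m Q)
           <= qrank (P *m M) + qrank (M *m Q))%N].
Proof.
pose W := P *m M *m Q.
have [G [WGW GWG]] := refl_ginverse_exists W.
have [H PMH] := ginverse_exists (P *m M).
have [L MQL] := ginverse_exists (M *m Q).
pose S := (1%:M - W *m G) *m (P *m M).
pose T := M *m Q *m (1%:M - G *m W).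
have rS : qrank (P *m M) = (qrank W + qrank S)%N := qrank_sub_colspace WGW.
have WE : W = P *m (M *m Q) by rewrite /W mulmxA.
have rT : qrank (M *m Q) = (qrank W + qrank T)%N.
  by rewrite /T WE; apply: qrank_sub_rowspace; rewrite -WE.
have SQ : S *m Q = 0 by rewrite -mulmxA mulmxBl mul1mx WGW subrr.
have PT : P *m T = 0.
  by rewrite mulmxA (mulmxA P) mulmxBr mulmx1 mulmxA WGW subrr.
(* The first summand gives [MQ G PM], of rank at most [r(W)], which misses [S] after multiplication
   by [P] and [T] after multiplication by [Q]. The other two restore [S] and [T] without disturbing
   each other, as [SQ = 0] and [PT = 0]. *)
pose Z := Q *m G *m P + H *m (1%:M - W *m G) *m P
            + Q *m (1%:M - G *m W) *m L.
have ZE : M *m Z *m M = M *m Q *m G *m (P *m M) + M *m H *m S + T *m L *m M.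
  by rewrite /Z /S /T !(mulmxDr, mulmxDl) !mulmxA.
have PMHW : P *m M *m H *m W = W by rewrite /W (mulmxA (P *m M *m H)) PMH.
have WLMQ : W *m L *m (M *m Q) = W by rewrite WE -2!(mulmxA P) MQL.
have PMHS : P *m M *m H *m S = S.
  rewrite /S mulmxBl mul1mx mulmxBr PMH; congr (_ - _).
  by rewrite 2!(mulmxA (P *m M *m H)) PMHW.
have TLMQ : T *m L *m (M *m Q) = T.
  rewrite /T mulmxBr mulmx1 !mulmxBl MQL; congr (_ - _).
  by rewrite -2!(mulmxA (M *m Q)) -2!(mulmxA G) WLMQ.
exists Z; rewrite ZE; split.
- rewrite !mulmxDr -(mulmxA T) (mulmxA P T) PT mul0mx addr0 !(mulmxA P) PMHS.
  by rewrite /S mulmxBl mul1mx addrC subrK.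
- rewrite !mulmxDl -(mulmxA (M *m H)) SQ mulmx0 addr0 -(mulmxA (T *m L)) TLMQ.
  rewrite -(mulmxA (M *m Q *m G)) -/W -(mulmxA (M *m Q)).
  by rewrite /T mulmxBr mulmx1 addrC subrK.
rewrite -/W rS rT [leqRHS]addnA [leqRHS]addnAC leq_add2r.
apply: leq_trans (qrankD _ _) _; apply: leq_add; last first.
  by rewrite -(mulmxA T); exact: qrank_mulmxr.
apply: leq_trans (qrankD _ _) _; apply: leq_add; last exact: qrank_mulmxl.
(* Reflexivity [G W G = G] exposes a factor [W], which bounds the rank by [r(W)]. *)
have -> : M *m Q *m G *m (P *m M) = M *m Q *m G *m W *m (G *m (P *m M)).
  by rewrite -{1}GWG !mulmxA.
exact: qrank_mulmx3.
Qed.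

(** * Minimal rank over the solution set *)

Lemma is_min_qrank_X m n p1 p2 q1 q2 (A : 'M[K]_(m, n))
    (B : 'M[K]_(m, p1)) (C : 'M[K]_(m, p2))
    (D : 'M[K]_(q1, n)) (E : 'M[K]_(q2, n)) :
  (exists (X : 'M[K]_(p1, q1)) (Y : 'M[K]_(p2, q2)),
     B *m X *m D + C *m Y *m E = A) ->
  is_min [set r : int | exists (X : 'M[K]_(p1, q1)) (Y : 'M[K]_(p2, q2)),
            B *m X *m D + C *m Y *m E = A /\ r = (qrank X)%:Z]
    ((qrank (row_mx A C))%:Z + (qrank (col_mx A E))%:Z
       - (qrank (block_mx A C E 0))%:Z).
Proof.
move=> [X0 [Y0 XY0]].
have [c CcC] := ginverse_exists C; have [e EeE] := ginverse_exists E.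
rewrite (qrank_row_mx _ CcC) (qrank_col_mx _ EeE) (qrank_block_mx0 _ CcC EeE).
set P := 1%:M - C *m c; set Q := 1%:M - e *m E.
have PC : P *m C = 0 by rewrite mulmxBl mul1mx CcC subrr.
have EQ : E *m Q = 0 by rewrite mulmxBr mulmx1 mulmxA EeE subrr.
have PA X Y : B *m X *m D + C *m Y *m E = A -> P *m A = P *m (B *m X *m D).
  by move=> <-; rewrite mulmxDr !mulmxA PC !mul0mx addr0.
have AQ X Y : B *m X *m D + C *m Y *m E = A -> A *m Q = B *m X *m D *m Q.
  by move=> <-; rewrite mulmxDl -(mulmxA _ E) EQ mulmx0 addr0.
have lower X Y : B *m X *m D + C *m Y *m E = A ->
    (qrank (P *m A) + qrank (A *m Q) <= qrank X + qrank (P *m A *m Q))%N.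
  move=> XY; rewrite (PA _ _ XY) (AQ _ _ XY).
  by apply: leq_trans (qrank_Frobenius _ _ _) _; rewrite leq_add2r qrank_mulmx3.
split; last by move=> _ [X [Y [/lower XY ->]]]; lia.
have [Z] := qrank_Frobenius_attained P (B *m X0 *m D) Q.
rewrite -(PA _ _ XY0) -(AQ _ _ XY0).
set M := B *m X0 *m D; set N := M *m Z *m M => -[PN NQ rN].
have [b BbB] := ginverse_exists B; have [d DdD] := ginverse_exists D.
(* [Y] absorbs the change [M - N] that replacing [X0] by [X] causes in the first term. *)
pose X := b *m N *m d; pose Y := Y0 + c *m (M - N) *m e.
have XN : B *m X *m D = N.
  rewrite /X /N /M !mulmxA BbB -!mulmxA; do !congr (_ *m _).
  by rewrite mulmxA DdD.
(* [P (M - N) = 0] and [(M - N) Q = 0] say that [C c] and [e E] fix [M - N]. *)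
have CY : C *m (c *m (M - N) *m e) *m E = M - N.
  have CM : C *m c *m (M - N) = M - N.
    apply/eqP; rewrite -subr_eq0 -opprB oppr_eq0 -{1}[M - N]mul1mx -mulmxBl -/P.
    by rewrite mulmxBr PN (PA _ _ XY0) subrr.
  rewrite !mulmxA CM -mulmxA.
  apply/eqP; rewrite -subr_eq0 -opprB oppr_eq0 -{1}[M - N]mulmx1 -mulmxBr -/Q.
  by rewrite mulmxBl NQ (AQ _ _ XY0) subrr.
have XY : B *m X *m D + C *m Y *m E = A.
  by rewrite XN /Y (mulmxDr C) mulmxDl CY addrCA subrKC addrC.
exists X, Y; split=> //.
have rX : (qrank X + qrank (P *m A *m Q) <= qrank (P *m A) + qrank (A *m Q))%N.
  by apply: leq_trans rN; rewrite leq_add2r qrank_mulmx3.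
(* The lower bound at this same [X] turns [rX] into an equality. *)
by have := lower _ _ XY; lia.
Qed.

End QuaternionRank.

Theorem theorem4p2 (R : realType) (m n p1 p2 q1 q2 : nat)
    (A : 'M[quat R]_(m, n))
    (B : 'M[quat R]_(m, p1)) (C : 'M[quat R]_(m, p2))
    (D : 'M[quat R]_(q1, n)) (E : 'M[quat R]_(q2, n)) :
  (exists (X : 'M[quat R]_(p1, q1)) (Y : 'M[quat R]_(p2, q2)),
     B *m X *m D + C *m Y *m E = A) ->
  is_min [set r : int | exists (X : 'M[quat R]_(p1, q1)) (Y : 'M[quat R]_(p2, q2)),
            B *m X *m D + C *m Y *m E = A /\ r = (qrank X)%:Z]
    ((qrank (row_mx A C))%:Z + (qrank (col_mx A E))%:Z
       - (qrank (block_mx A C E 0))%:Z) /\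
  is_min [set r : int | exists (X : 'M[quat R]_(p1, q1)) (Y : 'M[quat R]_(p2, q2)),
            B *m X *m D + C *m Y *m E = A /\ r = (qrank Y)%:Z]
    ((qrank (row_mx A B))%:Z + (qrank (col_mx A D))%:Z
       - (qrank (block_mx A B D 0))%:Z).
Proof.
move=> XY; split; first exact: is_min_qrank_X.
(* Swapping [(B, X, D)] with [(C, Y, E)] only permutes the two terms of the equation. *)
have [|[Y [X [YX rY]]] lbY] := @is_min_qrank_X R m n p2 p1 q2 q1 A C B E D.
  by have [X [Y XYA]] := XY; exists Y, X; rewrite addrC.
split; first by exists X, Y; rewrite addrC.
by move=> r [X' [Y' [XY' ->]]]; apply: lbY; exists Y', X'; rewrite addrC.
Qed.
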